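(* Let $1<p<\infty$, $r>0$, and let $\Omega\subset\mathbb{R}^2$ be a bounded domain whose singularity at the origin is of the form $|y|<x(-\ln x)^{-r}$, i.e. there is $\delta\in(0,1)$ such that $$\Omega\cap B_\delta(0)=\{(x,y)\in\mathbb{R}^2:\ 0<x<1,\ |y|<x(-\ln x)^{-r}\}\cap B_\delta(0).$$ Let $$\alpha\in\left(\frac{-r}{p},\ \frac{-r}{p}+r\right]$$ and let $f\in\overline{L^p(\Omega)}$ satisfy $f(x,y)\simeq x^{-\frac{2}{p}}(-\ln x)^{-\frac{1}{p}-\alpha}$ near the origin. Then there is no $\mathbf{u}\in (W^{1,p}_0(\Omega))^2$ with $\operatorname{div}\mathbf{u}=f$ a.e. in $\Omega$.
   Context: $B_\delta(0)$ is the open ball of radius $\delta$ centered at the origin. $\overline{L^p(\Omega)}:=\{f\in L^p(\Omega):\int_\Omega f\,dx=0\}$. $W^{1,p}_0(\Omega)$ is the closure of the smooth functions compactly supported in $\Omega$ in the $W^{1,p}$ norm. The notation $f(x,y)\simeq\psi(x)$ near the origin, for a positive function $\psi$ on a right neighborhood of $0$, means that the ratio $f(x,y)/\psi(x)$ has an (essential) limit in $(0,\infty)$ as $(x,y)\to(0,0)$ in $\Omega$: there is $c\in(0,\infty)$ such that for every $\varepsilon>0$ there is $\eta>0$ with $|f(x,y)/\psi(x)-c|\le\varepsilon$ for a.e. $(x,y)\in\Omega\cap B_\eta(0)$. *)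

(* Defs.v *)
From HB Require Import structures.
From mathcomp Require Import all_boot all_order all_algebra.
From mathcomp Require Import all_classical all_reals all_analysis.
Set Implicit Arguments.
Unset Strict Implicit.
Unset Printing Implicit Defensive.
Import Order.TTheory GRing.Theory Num.Theory.
Import numFieldNormedType.Exports.
Local Open Scope classical_set_scope.
Local Open Scope ring_scope.

Definition leb2 (R : realType) :
    {measure set (measurableTypeR R * measurableTypeR R)%type -> \bar R} :=
  (@lebesgue_measure R \x @lebesgue_measure R)%E.

(* The library's [ball] on [R * R] is that of the max norm; this is the
   Euclidean one. *)
Definition eball0 (R : realType) (d : R) : set (R * R)%type :=
  [set z | Num.sqrt (z.1 ^+ 2 + z.2 ^+ 2) < d].

Definition bounded_domain (R : realType) (Omega : set (R * R)%type) : Prop :=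
  [/\ open Omega, connected Omega, bounded_set Omega & Omega !=set0].

(* [f \_ Omega] is [f] extended by [0] outside [Omega], so that membership and
   norm only depend on the values of [f] on [Omega]. *)
Definition in_Lp (R : realType) (Omega : set (R * R)%type) (p : R)
    (f : R * R -> R) : Prop :=
  f \_ Omega \in Lfun (@leb2 R) p%:E.

Definition Lp_norm (R : realType) (Omega : set (R * R)%type) (p : R)
    (f : R * R -> R) : \bar R :=
  'N[@leb2 R]_p%:E [EFin \o (f \_ Omega)].

Definition in_Lp_mean0 (R : realType) (Omega : set (R * R)%type) (p : R)
    (f : R * R -> R) : Prop :=
  in_Lp Omega p f /\ (\int[@leb2 R]_(z in Omega) (f z)%:E = 0)%E.

Fixpoint Ck (R : realType) (k : nat) (phi : R * R -> R) : Prop :=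
  continuous phi /\
  if k is k'.+1 then
    [/\ forall z, derivable phi z (1, 0), forall z, derivable phi z (0, 1),
        Ck k' ('D_(1, 0) phi) & Ck k' ('D_(0, 1) phi)]
  else True.

(* Smooth functions with compact support in [Omega], as functions on the whole
   plane. *)
Definition test_fun (R : realType) (Omega : set (R * R)%type)
    (phi : R * R -> R) : Prop :=
  [/\ forall k, Ck k phi,
      compact (closure [set z | phi z != 0]) &
      closure [set z | phi z != 0] `<=` Omega].

Definition weak_partial (R : realType) (Omega : set (R * R)%type) (v : R * R)
    (u g : R * R -> R) : Prop :=
  forall phi, test_fun Omega phi ->
    Rintegral (@leb2 R) Omega (fun z => u z * 'D_v phi z) =
    - Rintegral (@leb2 R) Omega (fun z => g z * phi z).

(* An element of W^{1,p}(Omega), represented by a function together with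
   representatives of its weak partial derivatives, which are determined by the
   function up to a null set. *)
Record W1p (R : realType) (Omega : set (R * R)%type) (p : R) := MkW1p {
  W1p_fun :> R * R -> R ;
  W1p_dx : R * R -> R ;
  W1p_dy : R * R -> R ;
  W1p_fun_Lp : in_Lp Omega p W1p_fun ;
  W1p_dx_Lp : in_Lp Omega p W1p_dx ;
  W1p_dy_Lp : in_Lp Omega p W1p_dy ;
  W1p_dxP : weak_partial Omega (1, 0) W1p_fun W1p_dx ;
  W1p_dyP : weak_partial Omega (0, 1) W1p_fun W1p_dy
}.

(* The W^{1,p} norm of [u - phi]; the weak derivatives of the smooth [phi] are
   its classical ones. *)
Definition W1p_dist (R : realType) (Omega : set (R * R)%type) (p : R)
    (u : W1p Omega p) (phi : R * R -> R) : \bar R :=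
  (Lp_norm Omega p (u \- phi)%R +
   Lp_norm Omega p (W1p_dx u \- 'D_(1, 0) phi)%R +
   Lp_norm Omega p (W1p_dy u \- 'D_(0, 1) phi)%R)%E.

Definition in_W1p0 (R : realType) (Omega : set (R * R)%type) (p : R)
    (u : W1p Omega p) : Prop :=
  forall eps : R, 0 < eps ->
    exists2 phi, test_fun Omega phi & (W1p_dist u phi < eps%:E)%E.

Definition div2 (R : realType) (Omega : set (R * R)%type) (p : R)
    (u : W1p Omega p * W1p Omega p) : R * R -> R :=
  W1p_dx u.1 \+ W1p_dy u.2.

(* f(x,y) ~= psi(x) as (x,y) -> 0 in Omega *)
Definition sim0 (R : realType) (Omega : set (R * R)%type) (f : R * R -> R)
    (psi : R -> R) : Prop :=
  exists2 c : R, 0 < c &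
    forall eps : R, 0 < eps -> exists2 eta : R, 0 < eta &
      {ae @leb2 R, forall z, (Omega `&` eball0 eta) z ->
        `|f z / psi z.1 - c| <= eps}.

Definition log_cusp (R : realType) (r : R) : set (R * R)%type :=
  [set z | 0 < z.1 < 1 /\ `|z.2| < z.1 * (- ln z.1) `^ (- r)].

(* Main.v *)
Require Import Defs.
From HB Require Import structures.
From mathcomp Require Import all_boot all_order all_algebra.
From mathcomp Require Import all_classical all_reals all_analysis.
From mathcomp Require Import measurable_realfun ring lra.
Set Implicit Arguments.
Unset Strict Implicit.
Unset Printing Implicit Defensive.
Import Order.TTheory GRing.Theory Num.Theory.
Import numFieldNormedType.Exports.
Local Open Scope classical_set_scope.
Local Open Scope ring_scope.

(** Write $L = -\ln t$ and let $w(t) = t L^{-r}$ be half the length of the slice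
    of the cusp at abscissa $t$ ([cusp_width]).  Suppose $u = (u_1, u_2)$ has
    zero boundary values and $\mathrm{div}\, u = f$.  By the divergence theorem
    the integral $F(t)$ of $f$ over the part of the cusp left of $t$ is the flux
    of $u_1$ through the slice at $t$; as $u_1$ vanishes at both ends of the
    slice, this flux is at most $2 w(t) \int |\partial_y u_1(t, y)|\,dy$
    ([flux_le]).  On the other hand, with $1/p + 1/q = 1$ and
    $b = 1/p + r/q$, the upper bound on $\alpha$ says that $f$ is at least a
    multiple of $x^{-2/p} L^{-b}$, so that $F(t)$ is at least a multiple of
    $t^{1-2/p} L^{-b} w(t)$ ([flux_ge]).

    These two bounds collide.  Multiply them by $\sigma / w$, where
    $\sigma(t) = t^{-2/q} L^{(r-1)/q}$ ([flux_weight]), and integrate over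
    $[e, a]$.  The weight makes the lower bound a multiple of
    $I = \int_e^a dt / (t L)$, and Young's inequality bounds the double integral
    of $\sigma |\partial_y u_1|$ by
    $l \int \sigma^q \cdot 2 w\,dt + C_l \|\partial_y u_1\|_p^p
     = 2 l I + C_l \|\partial_y u_1\|_p^p$
    ([weighted_flux_le]).  For $l$ small this bounds $I$ independently of $e$,
    whereas $I = \ln L(e) - \ln L(a)$ is unbounded ([integral_dlnln]).

    Traces never appear: the divergence theorem is applied to test functions
    $\varphi$, $\psi$ approximating $u_1$, $u_2$, which are chosen after $e$.
    The errors $\partial_x u_1 - \partial_x \varphi$,
    $\partial_y u_2 - \partial_y\psi$ and $\partial_y u_1 - \partial_y \varphi$
    enter through their $L^1$ norms near the origin, multiplied by a bound $G$
    for the weights on $[e, a]$. *)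

(** * Measurability in the plane *)

(** An open set of the plane is the union of the open rectangles with rational
    vertices that it contains, hence belongs to the product of the Borel
    sigma-algebras. *)
Lemma open_measurable_plane (R : realType) (U : set (R * R)) :
  open U -> measurable (U : set (measurableTypeR R * measurableTypeR R)).
Proof.
move=> oU.
pose box (q : (rat * rat) * (rat * rat)) : set (R * R) :=
  `]ratr q.1.1, ratr q.1.2[ `*` `]ratr q.2.1, ratr q.2.2[.
have -> : U = \bigcup_q (if `[< box q `<=` U >] then box q else set0).
  apply/seteqP; split=> [[x y] Uxy|z [q _]]; last first.
    by case: ifPn => // /asboolP; apply.
  have [[A B] /= [Ax By] ABU] := oU _ Uxy.
  have [e /= e0 xA] := Ax; have [e' /= e'0 yB] := By.
  have [a ha] := @rat_in_itvoo R (x - e) x ltac:(by rewrite ltrBlDr ltrDl).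
  have [b hb] := @rat_in_itvoo R x (x + e) ltac:(by rewrite ltrDl).
  have [c hc] := @rat_in_itvoo R (y - e') y ltac:(by rewrite ltrBlDr ltrDl).
  have [d hd] := @rat_in_itvoo R y (y + e') ltac:(by rewrite ltrDl).
  move: ha hb hc hd; rewrite !in_itv/=.
  move=> /andP[a1 a2] /andP[b1 b2] /andP[c1 c2] /andP[d1 d2].
  exists ((a, b), (c, d)) => //=.
  rewrite ifT; first by split; rewrite /= in_itv/= ?a2 ?c2 ?b1 ?d1.
  apply/asboolP => -[u v] [/=]; rewrite !in_itv/=.
  move=> /andP[au ub] /andP[cv vd]; apply: ABU; split => /=.
    by apply: xA => /=; rewrite distrC ltr_distl; apply/andP; split; lra.
  by apply: yB => /=; rewrite distrC ltr_distl; apply/andP; split; lra.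
apply: countable_bigcupT_measurable => // q.
by case: ifPn => // _; apply: measurableX; exact: measurable_itv.
Qed.

Lemma continuous_measurable_plane (R : realType) (F : R * R -> R) :
  continuous F ->
  measurable_fun setT (F : measurableTypeR R * measurableTypeR R -> R).
Proof.
move=> /continuousP cF; apply: (measurability _ (RGenOpens.measurableE R)).
move=> _ [_ [a [b ->] <-]]; rewrite setTI; apply: open_measurable_plane.
exact/cF/interval_open.
Qed.

(** * One-dimensional slices of functions of class C1 *)

Definition C1 (R : realType) (phi : R * R -> R) : Prop :=
  [/\ continuous phi,
      forall z, derivable phi z (1, 0), forall z, derivable phi z (0, 1),
      continuous ('D_(1, 0) phi) & continuous ('D_(0, 1) phi)].

Section Slices.
Variable R : realType.
Implicit Types (phi F : R * R -> R).

Lemma hslice_quotient phi (x y : R) :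
  (fun h : R => h^-1 *: (phi (h *: (1, 0) + (x, y)) - phi (x, y))) =
  (fun h : R => h^-1 *: (phi (h *: 1 + x, y) - phi (x, y))).
Proof.
apply/funext => h; congr (_ *: (phi _ - _)).
by congr pair; rewrite /= scaler0 add0r.
Qed.

Lemma vslice_quotient phi (x y : R) :
  (fun h : R => h^-1 *: (phi (h *: (0, 1) + (x, y)) - phi (x, y))) =
  (fun h : R => h^-1 *: (phi (x, h *: 1 + y) - phi (x, y))).
Proof.
apply/funext => h; congr (_ *: (phi _ - _)).
by congr pair; rewrite /= scaler0 add0r.
Qed.

Lemma continuous_hslice F y : continuous F -> continuous (fun x => F (x, y)).
Proof.
move=> cF x; apply: (@continuous_comp _ _ _ (fun x => (x, y)) F); last exact: cF.
exact: (@cvg_pair _ _ _ (nbhs x) (nbhs x) (nbhs y) _ _ _ id (cst y) cvg_id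
  (cvg_cst _)).
Qed.

Lemma continuous_vslice F x : continuous F -> continuous (fun y => F (x, y)).
Proof.
move=> cF y; apply: (@continuous_comp _ _ _ (fun y => (x, y)) F); last exact: cF.
exact: (@cvg_pair _ _ _ (nbhs y) (nbhs x) (nbhs y) _ _ _ (cst x) id
  (cvg_cst _) cvg_id).
Qed.

Lemma FTC_C1 (f : R -> R) (f' : R -> R) a b : a <= b -> continuous f ->
  continuous f' -> (forall x, derivable f x 1) -> derive1 f =1 f' ->
  (\int[lebesgue_measure]_(x in `[a, b]) (f' x)%:E = (f b - f a)%:E)%E.
Proof.
rewrite le_eqVlt => /predU1P[->|ab] cf cf' df f'E.
  by rewrite set_itv1 integral_set1 subrr.
rewrite (@continuous_FTC2 _ f' f)// ?EFinB//.
- exact: continuous_subspaceT.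
- split=> [x _| |]; first exact: df.
    by apply: cvg_at_right_filter; exact: cf.
  by apply: cvg_at_left_filter; exact: cf.
Qed.

Lemma FTC_hslice phi a b y : a <= b -> C1 phi ->
  (\int[lebesgue_measure]_(x in `[a, b]) ('D_(1, 0) phi (x, y))%:E =
   (phi (b, y) - phi (a, y))%:E)%E.
Proof.
move=> ab [cphi dphi _ cdphi _].
apply: (@FTC_C1 (fun x => phi (x, y)) (fun x => 'D_(1, 0) phi (x, y))) => //.
- exact: continuous_hslice.
- exact: (@continuous_hslice ('D_(1, 0) phi)).
- by move=> x; rewrite /derivable -(hslice_quotient phi x y); exact: dphi.
- by move=> x; rewrite derive1E /derive hslice_quotient.
Qed.

Lemma FTC_vslice phi a b x : a <= b -> C1 phi ->
  (\int[lebesgue_measure]_(y in `[a, b]) ('D_(0, 1) phi (x, y))%:E =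
   (phi (x, b) - phi (x, a))%:E)%E.
Proof.
move=> ab [cphi _ dphi _ cdphi].
apply: (@FTC_C1 (fun y => phi (x, y)) (fun y => 'D_(0, 1) phi (x, y))) => //.
- exact: continuous_vslice.
- exact: (@continuous_vslice ('D_(0, 1) phi)).
- by move=> y; rewrite /derivable -(vslice_quotient phi x y); exact: dphi.
- by move=> y; rewrite derive1E /derive vslice_quotient.
Qed.

End Slices.

(** * Integration over rectangles *)

Section Boxes.
Variable R : realType.
Local Notation mu := (@lebesgue_measure R).
Local Notation plane := (measurableTypeR R * measurableTypeR R)%type.
Implicit Types (A B : set (measurableTypeR R)) (f : plane -> \bar R).
Local Open Scope ereal_scope.

Lemma leb2_setX A B : measurable A -> measurable B ->
  @leb2 R (A `*` B) = mu A * mu B.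
Proof. by move=> mA mB; exact: product_measure1E. Qed.

Lemma leb2_box (a b c d : R) (s1 s2 s3 s4 : bool) : (a <= b)%R -> (c <= d)%R ->
  @leb2 R ([set` Interval (BSide s1 a) (BSide s2 b)] `*`
           [set` Interval (BSide s3 c) (BSide s4 d)]) =
  ((b - a) * (d - c))%:E.
Proof.
have len u v s s' : (u <= v)%R ->
    mu [set` Interval (BSide s u) (BSide s' v)] = (v - u)%:E.
  move=> uv; rewrite lebesgue_measure_itv/= lte_fin; case: ltP => [_|vu].
    by rewrite EFinB.
  by rewrite (@le_anti _ _ u v) ?uv// subrr.
by move=> ab cd; rewrite leb2_setX ?len//; exact: measurable_itv.
Qed.

Lemma restrict_setX_vsection A B f x :
  \int[mu]_y (f \_ (A `*` B)) (x, y) =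
  ((fun x => \int[mu]_(y in B) f (x, y)) \_ A) x.
Proof.
rewrite patchE; case: ifPn => xA; last first.
  rewrite integral0_eq// => y _; rewrite patchE ifF//.
  by apply/negbTE; apply: contra xA => /set_mem[/= Ax _]; exact/mem_set.
rewrite [RHS]integral_mkcond; apply: eq_integral => y _.
rewrite !patchE; congr (if _ then _ else _).
apply/idP/idP => [/set_mem[]|/set_mem] By; first by move=> ?; exact/mem_set.
by apply/mem_set; split => //=; exact/set_mem.
Qed.

Lemma restrict_setX_hsection A B f y :
  \int[mu]_x (f \_ (A `*` B)) (x, y) =
  ((fun y => \int[mu]_(x in A) f (x, y)) \_ B) y.
Proof.
rewrite patchE; case: ifPn => yB; last first.
  rewrite integral0_eq// => x _; rewrite patchE ifF//.
  by apply/negbTE; apply: contra yB => /set_mem[/= _ By]; exact/mem_set.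
rewrite [RHS]integral_mkcond; apply: eq_integral => x _.
rewrite !patchE; congr (if _ then _ else _).
apply/idP/idP => [/set_mem[Ax _]|/set_mem Ax]; first exact/mem_set.
by apply/mem_set; split => //=; exact/set_mem.
Qed.

Lemma tonelli_setX A B f : measurable A -> measurable B ->
  (forall z, 0 <= f z) -> measurable_fun setT f ->
  \int[@leb2 R]_(z in A `*` B) f z = \int[mu]_(x in A) \int[mu]_(y in B) f (x, y).
Proof.
move=> mA mB f0 mf; rewrite integral_mkcond fubini_tonelli1.
- rewrite [RHS]integral_mkcond; apply: eq_integral => x _.
  exact: restrict_setX_vsection.
- apply/(measurable_restrictT _ _).1; first exact: measurableX.
  exact: measurable_funS mf.
- by move=> z; rewrite patchE; case: ifPn.
Qed.

Lemma measurable_fun_vintegral B f : measurable B ->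
  (forall z, 0 <= f z) -> measurable_fun setT f ->
  measurable_fun setT (fun x => \int[mu]_(y in B) f (x, y)).
Proof.
move=> mB f0 mf.
have -> : (fun x => \int[mu]_(y in B) f (x, y)) =
    (fun x => \int[mu]_y (f \_ (setT `*` B)) (x, y)).
  by apply/funext => x; rewrite restrict_setX_vsection patchE mem_set.
apply: (measurable_fun_fubini_tonelli_F (f \_ (setT `*` B))).
- apply/(measurable_restrictT _ _).1; first exact: measurableX.
  exact: measurable_funS mf.
- by move=> z; rewrite patchE; case: ifPn.
Qed.

Section continuous.
Variables (F : R * R -> R) (a b c d : R).
Hypothesis cF : continuous F.

Lemma integrable_box :
  (@leb2 R).-integrable (`[a, b] `*` `[c, d]) (EFin \o F).
Proof.
apply: measurable_bounded_integrable.
- by apply: measurableX; exact: measurable_itv.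
- rewrite leb2_setX; [|exact: measurable_itv..].
  by rewrite lte_mul_pinfty// ?ge0_fin_numE// lebesgue_measure_itv;
    case: ifPn => // _; rewrite -EFinB ltry.
- apply: measurable_funS (continuous_measurable_plane cF) => //.
- have /compact_bounded : compact (F @` (`[a, b] `*` `[c, d])).
    apply: continuous_compact; first exact: continuous_subspaceT.
    by apply: compact_setX; exact: segment_compact.
  move=> [M [Mr FM]]; exists M; split => // x Mx z Qz.
  by apply: (FM _ Mx); exists z.
Qed.

Lemma fubini_box :
  (\int[@leb2 R]_(z in `[a, b] `*` `[c, d]) (F z)%:E =
   \int[mu]_(x in `[a, b]) \int[mu]_(y in `[c, d]) (F (x, y))%:E) /\
  (\int[@leb2 R]_(z in `[a, b] `*` `[c, d]) (F z)%:E =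
   \int[mu]_(y in `[c, d]) \int[mu]_(x in `[a, b]) (F (x, y))%:E).
Proof.
have mQ : measurable (`[a, b] `*` `[c, d] : set plane).
  by apply: measurableX; exact: measurable_itv.
have iF : (@leb2 R).-integrable setT
    ((EFin \o F) \_ (`[a, b] `*` `[c, d])).
  by apply/integrable_restrict => //; rewrite setTI; exact: integrable_box.
split; rewrite integral_mkcond.
- rewrite -integral12_prod_meas1// [RHS]integral_mkcond.
  by apply: eq_integral => x _; exact: restrict_setX_vsection.
- rewrite -integral21_prod_meas1// [RHS]integral_mkcond.
  by apply: eq_integral => x _; exact: restrict_setX_hsection.
Qed.

End continuous.

End Boxes.

(** * Flux through a slice *)

Section Flux.
Variables (R : realType) (phi psi : R * R -> R) (a t w : R).
Local Notation mu := (@lebesgue_measure R).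
Hypotheses (phiC1 : C1 phi) (psiC1 : C1 psi).
Hypotheses (t_ge0 : 0 <= t) (a_ge0 : 0 <= a) (w_ge0 : 0 <= w).
Hypothesis phi_left : forall y, - a <= y <= a -> phi (0, y) = 0.
Hypothesis phi_right : forall y, - a <= y <= a -> w <= `|y| -> phi (t, y) = 0.
Hypothesis w_le_a : w <= a.
Hypothesis psi_bot : forall x, 0 <= x <= t -> psi (x, - a) = 0.
Hypothesis psi_top : forall x, 0 <= x <= t -> psi (x, a) = 0.

Let dphi_measurable D : measurable D ->
  measurable_fun (D : set (measurableTypeR R))
    (fun y => ('D_(0%R, 1%R) phi (t, y))%:E).
Proof.
move=> mD; apply/measurable_EFinP; apply: measurable_funTS.
apply: continuous_measurable_fun; apply: (@continuous_vslice _ ('D_(0%R, 1%R) phi)).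
by case: phiC1.
Qed.

(** The function vanishes at the bottom of the slice, so its values are
    integrals of its vertical derivative. *)
Lemma vslice_le_integral_derivative y : (- a <= y <= a)%R ->
  (`|phi (t, y)|%:E <=
   \int[mu]_(y in `[(- a)%R, a]) `|'D_(0%R, 1%R) phi (t, y)|%:E)%E.
Proof.
move=> /andP[ay ya].
have -> : phi (t, y) = (phi (t, y) - phi (t, - a))%R.
  by rewrite (@phi_right (- a)) ?subr0// ?normrN ?ger0_norm// lexx; lra.
rewrite -abse_EFin -(FTC_vslice _ ay phiC1).
apply: le_trans (le_abse_integral _ _ _) _ => //; first exact: dphi_measurable.
apply: ge0_subset_integral => //.
- by apply: measurableT_comp => //; exact: dphi_measurable.
- by apply: subset_itvl; rewrite bnd_simp.
Qed.

(** The divergence theorem on the rectangle: the vertical derivative integrates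
    to zero because [psi] vanishes on the two horizontal sides, and the
    horizontal one to the integral of [phi] over the right side, where [phi] is
    supported in an interval of length [2 * w] and bounded by the integral of
    its derivative. *)
Lemma flux_le :
  (\int[@leb2 R]_(z in `[0%R, t] `*` `[(- a)%R, a])
    ('D_(1%R, 0%R) phi z + 'D_(0%R, 1%R) psi z)%R%:E <=
  (2 * w)%R%:E * \int[mu]_(y in `[(- a)%R, a]) `|'D_(0%R, 1%R) phi (t, y)|%:E)%E.
Proof.
have Naa : - a <= a by rewrite (le_trans _ a_ge0)// oppr_le0.
have [_ _ _ cdphi _] := phiC1; have [_ _ _ _ cdpsi] := psiC1.
have mQ : measurable (`[0%R, t] `*` `[(- a)%R, a] :
    set (measurableTypeR R * measurableTypeR R)).
  by apply: measurableX; exact: measurable_itv.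
rewrite integralD_EFin//; [|exact: integrable_box..].
rewrite (fubini_box 0 t (- a) a cdphi).2 (fubini_box 0 t (- a) a cdpsi).1.
rewrite [X in (_ + X)%E]integral0_eq ?adde0; last first.
  move=> x /=; rewrite in_itv/= => xt.
  by rewrite (FTC_vslice _ Naa psiC1) psi_bot// psi_top// subrr.
set A := (\int[mu]_(y in `[(- a)%R, a]) `|'D_(0%R, 1%R) phi (t, y)|%:E)%E.
have A0 : (0 <= A)%E by apply: integral_ge0.
rewrite [leLHS](_ : _ =
  \int[mu]_(y in `[(- a)%R, a]) (phi (t, y))%:E)%E; last first.
  apply: eq_integral => y /set_mem/=; rewrite in_itv/= => ya.
  by rewrite (FTC_hslice _ t_ge0 phiC1) phi_left// subr0.
have mphi D : measurable_fun (D : set (measurableTypeR R))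
    (fun y => (phi (t, y))%:E).
  apply/measurable_EFinP; apply: measurable_funTS.
  by apply: continuous_measurable_fun; apply: continuous_vslice; case: phiC1.
apply: le_trans (lee_abs _) _.
apply: le_trans (le_abse_integral _ _ _) _ => //.
apply: (@le_trans _ _
  (\int[mu]_(y in `[(- a)%R, a]) (A * (\1_(`](- w)%R, w[%classic) y)%:E))%E).
  apply: ge0_le_integral => //.
  - by apply: measurableT_comp => //; exact: mphi.
  - by apply: measurable_funeM; apply/measurable_EFinP; apply: measurable_indic.
  - move=> y /=; rewrite in_itv/= => ya.
    rewrite indicE; case: (boolP (y \in _)) => yw.
      by rewrite mule1; exact: vslice_le_integral_derivative.
    rewrite phi_right ?normr0 ?mule0// leNgt; apply: contra yw => yw.
    by rewrite inE/= in_itv/= -ltr_norml.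
rewrite ge0_integralZl//; last first.
  by apply/measurable_EFinP; apply: measurable_indic.
rewrite muleC integral_indic//; apply: lee_wpmul2r => //.
apply: (@le_trans _ _ (mu `](- w)%R, w[)).
  by apply: le_measure; rewrite ?inE//; exact: measurableI.
rewrite lebesgue_measure_itv/=; case: ifPn => _.
  by rewrite -EFinB lee_fin; lra.
by rewrite lee_fin mulr_ge0.
Qed.

End Flux.

(** * Test functions *)

Section TestFunctions.
Variables (R : realType) (Omega : set (R * R)) (phi : R * R -> R).
Hypothesis tphi : test_fun Omega phi.

Lemma test_fun_C1 : C1 phi.
Proof.
have [/(_ 1%N)[cphi [dx dy [cdx _] [cdy _]]] _ _] := tphi.
exact: And5 cphi dx dy cdx cdy.
Qed.

Let near_zero_out z : ~ Omega z -> \near z, phi z = 0.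
Proof.
have [_ _ sub] := tphi => zO.
have : nbhs z (~` closure [set z | phi z != 0]).
  apply: open_nbhs_nbhs; split; last by move=> /sub.
  exact/closed_openC/closed_closure.
apply: filterS => u uN; apply/eqP; apply: contra_notT uN => u0.
exact: subset_closure.
Qed.

Lemma test_fun_out z : ~ Omega z -> phi z = 0.
Proof. by move=> /near_zero_out /nbhs_singleton. Qed.

Lemma derive_test_fun_out v z : ~ Omega z -> 'D_v phi z = 0.
Proof.
move=> /near_zero_out z0; rewrite -(derive_cst (0 : R) z v).
by apply: near_eq_derive.
Qed.

End TestFunctions.

(** * The width of the cusp and the weight *)

Definition cusp_width (R : realType) (r x : R) : R := x * (- ln x) `^ (- r).

(** The weight $\sigma$ is the extremal one in the duality between $L^p$ and
    $L^q$: both $\sigma^q w$, half the integral of $\sigma^q$ over a slice of the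
    cusp, and $t^{1-2/p} L^{-b} \sigma$, the lower bound of the flux multiplied
    by $\sigma / w$, equal $1/(t L)$, whose integral barely diverges at the
    origin; see [flux_weight_width] and [density_flux_weight]. *)
Definition flux_weight (R : realType) (r q t : R) : R :=
  t `^ (- 2 / q) * (- ln t) `^ ((r - 1) / q).

Section Cusp.
Variables (R : realType) (r : R).
Hypothesis r_gt0 : 0 < r.
Implicit Types x t : R.

Local Notation w := (cusp_width r).

Lemma powR_mulD (x b c : R) : 0 < x -> x `^ b * x `^ c = x `^ (b + c).
Proof. by move=> x0; rewrite powRD// (gt_eqF x0) implybT. Qed.

Lemma ler_powRl (b u v : R) : 0 <= b -> 0 <= u -> u <= v -> u `^ b <= v `^ b.
Proof.
by move=> b0 u0 uv; apply: ge0_ler_powR; rewrite ?nnegrE// (le_trans u0).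
Qed.

Lemma ger_powRl (b u v : R) : 0 <= b -> 0 < u -> u <= v ->
  v `^ (- b) <= u `^ (- b).
Proof.
move=> b0 u0 uv; have v0 := lt_le_trans u0 uv.
by rewrite !powRN lef_pV2 ?posrE ?powR_gt0// ler_powRl// ltW.
Qed.

Lemma Nln_ge1 x : 0 < x <= expR (-1) -> 1 <= - ln x.
Proof.
move=> /andP[x0 x1]; rewrite lerNr -[leRHS]expRK ler_ln// posrE ?expR_gt0//.
Qed.

Lemma Nln_gt0 x : 0 < x <= expR (-1) -> 0 < - ln x.
Proof. by move=> /Nln_ge1; apply: lt_le_trans. Qed.

Lemma ler_Nln x t : 0 < x -> x <= t -> - ln t <= - ln x.
Proof. by move=> x0 xt; rewrite lerN2 ler_ln// posrE// (lt_le_trans x0). Qed.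

(** Halving $t$ adds $\ln 2 \leq 1 \leq L$ to $L$, so at most doubles it:
    powers of $L$ vary by bounded factors over $[t/2, t]$. *)
Lemma Nln_half x t : 0 < t <= expR (-1) -> t / 2 <= x -> - ln x <= 2 * - ln t.
Proof.
move=> t1 tx; have t0 : 0 < t by case/andP: t1.
have /ler_Nln/(_ tx) : 0 < t / 2 by rewrite divr_gt0.
rewrite ln_div ?posrE// => /le_trans; apply.
have : ln 2 <= 1 :> R.
  by have := @le_ln1Dx R 1; rewrite (_ : 1 + 1 = 2)//; apply; lra.
have := Nln_ge1 t1; lra.
Qed.

Lemma cusp_width_gt0 x : 0 < x <= expR (-1) -> 0 < w x.
Proof.
move=> x1; have [x0 _] := andP x1.
by rewrite mulr_gt0// powR_gt0// Nln_gt0.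
Qed.

Lemma powR_Nln_le (b x t : R) : 0 <= b -> 0 < x -> x <= t -> t <= expR (-1) ->
  (- ln x) `^ (- b) <= (- ln t) `^ (- b).
Proof.
move=> b0 x0 xt t1; have t0 := lt_le_trans x0 xt.
by apply: ger_powRl => //; [apply: Nln_gt0; rewrite t0|exact: ler_Nln].
Qed.

Lemma cusp_width_le x : 0 < x <= expR (-1) -> w x <= x.
Proof.
move=> x1; have [x0 _] := andP x1.
apply: ler_piMr; first exact: ltW.
by rewrite -[leRHS](powRr0 (- ln x)) ler_powR ?Nln_ge1// oppr_le0 ltW.
Qed.

Lemma ler_cusp_width x t : 0 < x -> x <= t -> t <= expR (-1) -> w x <= w t.
Proof.
move=> x0 xt t1; apply: ler_pM => //; [exact: ltW|exact: powR_ge0|].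
by apply: powR_Nln_le => //; exact: ltW.
Qed.

Lemma powR_Nln_half (b x t : R) : 0 <= b -> 0 < t <= expR (-1) ->
  t / 2 <= x -> x <= t -> 2 `^ (- b) * (- ln t) `^ (- b) <= (- ln x) `^ (- b).
Proof.
move=> b0 t1 tx xt; have [t0 t1'] := andP t1.
have x0 : 0 < x by rewrite (lt_le_trans _ tx)// divr_gt0.
have Lx : 0 < - ln x by apply: Nln_gt0; rewrite x0 (le_trans xt).
have Lt := Nln_gt0 t1.
by rewrite -powRM ?(ltW Lt)// ger_powRl// (Nln_half t1).
Qed.

Lemma cusp_width_half t : 0 < t <= expR (-1) ->
  2 `^ (- r) / 2 * w t <= w (t / 2).
Proof.
move=> t1; have [t0 _] := andP t1.
have := powR_Nln_half (ltW r_gt0) t1 (lexx _) _.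
rewrite ler_pdivrMr// ler_peMr ?(ltW t0) ?ler1n// => /(_ isT) h.
rewrite /cusp_width [leLHS](_ : _ = t / 2 * (2 `^ (- r) * (- ln t) `^ (- r))).
  by rewrite ler_wpM2l// divr_ge0// ltW.
by ring.
Qed.

Lemma density_ge (p b c x t : R) : 0 < p -> c <= b -> 0 <= b ->
  0 < t <= expR (-1) -> t / 2 <= x -> x <= t ->
  2 `^ (- b) * (t `^ (- 2 / p) * (- ln t) `^ (- b)) <=
  x `^ (- 2 / p) * (- ln x) `^ (- c).
Proof.
move=> p0 cb b0 t1 tx xt; have [t0 t1'] := andP t1.
have x0 : 0 < x by rewrite (lt_le_trans _ tx)// divr_gt0.
have x1 : 0 < x <= expR (-1) by rewrite x0 (le_trans xt).
rewrite mulrCA; apply: ler_pM; rewrite ?mulr_ge0 ?powR_ge0//.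
  by rewrite mulNr ger_powRl// divr_ge0// ltW.
apply: le_trans (powR_Nln_half b0 t1 tx xt) _.
by apply: ler_powR; [exact: Nln_ge1|rewrite lerN2].
Qed.

Variables p q : R.
Hypotheses (p_gt0 : 0 < p) (q_gt0 : 0 < q) (pq : p^-1 + q^-1 = 1).

Lemma density_flux_weight t : 0 < t <= expR (-1) ->
  t `^ (- 2 / p) * (- ln t) `^ (- (p^-1 + r / q)) * t * flux_weight r q t =
  (t * - ln t)^-1.
Proof.
move=> t1; have [t0 _] := andP t1; have L0 := Nln_gt0 t1.
rewrite /flux_weight [LHS](_ : _ =
  (t `^ (- 2 / p) * t `^ 1 * t `^ (- 2 / q)) *
  ((- ln t) `^ (- (p^-1 + r / q)) * (- ln t) `^ ((r - 1) / q))); last first.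
  by rewrite powRr1 ?ltW//; ring.
rewrite !powR_mulD// invfM -(powR_inv1 (ltW t0)) -(powR_inv1 (ltW L0)).
congr (_ `^ _ * _ `^ _).
- by rewrite [LHS](_ : _ = 1 - 2 * (p^-1 + q^-1)); [rewrite pq; ring|ring].
- by rewrite [LHS](_ : _ = - (p^-1 + q^-1)); [rewrite pq; ring|ring].
Qed.

Lemma flux_weight_width t : 0 < t <= expR (-1) ->
  flux_weight r q t `^ q * w t = (t * - ln t)^-1.
Proof.
move=> t1; have [t0 _] := andP t1; have L0 := Nln_gt0 t1.
rewrite /flux_weight powRM ?powR_ge0// -!powRrM.
rewrite -!mulrA !mulVf ?gt_eqF// !mulr1 /cusp_width.
rewrite [LHS](_ : _ = (t `^ (- 2) * t `^ 1) *
  ((- ln t) `^ (r - 1) * (- ln t) `^ (- r))); last first.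
  by rewrite powRr1 ?ltW//; ring.
rewrite !powR_mulD// invfM -(powR_inv1 (ltW t0)) -(powR_inv1 (ltW L0)).
by congr (_ `^ _ * _ `^ _); ring.
Qed.

Lemma flux_weight_ge0 t : 0 <= flux_weight r q t.
Proof. by rewrite mulr_ge0// powR_ge0. Qed.

Lemma flux_weight_le e t : 0 < e -> e <= t -> t <= expR (-1) ->
  flux_weight r q t <= e `^ (- 2 / q) * (- ln e) `^ (r / q).
Proof.
move=> e0 et t1; have t0 := lt_le_trans e0 et.
have Le : 0 < - ln e by apply: Nln_gt0; rewrite e0 (le_trans et).
have Lt : 1 <= - ln t by apply: Nln_ge1; rewrite t0.
apply: ler_pM; rewrite ?powR_ge0//.
  by rewrite mulNr ger_powRl// divr_ge0// ltW.
apply: (@le_trans _ _ ((- ln t) `^ (r / q))).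
  by apply: ler_powR => //; rewrite ler_pM2r ?invr_gt0//; lra.
by apply: ler_powRl; rewrite ?divr_ge0 ?ler_Nln// ?ltW//; lra.
Qed.

Lemma measurable_flux_weight : measurable_fun setT (flux_weight r q).
Proof.
apply: measurable_funM; first exact: measurable_powR.
apply: (measurableT_comp (@measurable_powR _ _)).
by apply: measurableT_comp => //; exact: measurable_ln.
Qed.

Lemma measurable_cusp_width : measurable_fun setT w.
Proof.
apply: measurable_funM => //.
apply: (measurableT_comp (@measurable_powR _ _)).
by apply: measurableT_comp => //; exact: measurable_ln.
Qed.

End Cusp.

(** * Young's inequality and the divergent integral *)

Section OneDimensional.
Variable R : realType.

(** Young's inequality for $l^{1/q} s$ and $l^{-1/q} v$, with the constants
    $1/p$ and $1/q$ replaced by $1$. *)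
Lemma young_weighted (p q l s v : R) : 0 < p -> 0 < q -> p^-1 + q^-1 = 1 ->
  0 < l -> 0 <= s -> 0 <= v -> s * v <= l * s `^ q + l `^ (- p / q) * v `^ p.
Proof.
move=> p0 q0 pq l0 s0 v0.
have lq : l `^ q^-1 * l `^ (- q^-1) = 1.
  by rewrite powR_mulD// subrr powRr0.
have -> : s * v = (l `^ (- q^-1) * v) * (l `^ q^-1 * s).
  by rewrite [RHS](_ : _ = (l `^ q^-1 * l `^ (- q^-1)) * (s * v));
    [rewrite lq mul1r|ring].
apply: le_trans (conjugate_powR _ _ p0 q0 pq) _; rewrite ?mulr_ge0 ?powR_ge0//.
rewrite !powRM ?powR_ge0// -!powRrM mulVf ?gt_eqF// powRr1 ?(ltW l0)// addrC.
have p1 : p^-1 <= 1 by rewrite -pq lerDl invr_ge0 ltW.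
have q1 : q^-1 <= 1 by rewrite -pq lerDr invr_ge0 ltW.
rewrite (_ : - q^-1 * p = - p / q); last by ring.
by apply: lerD; apply: ler_piMr => //; rewrite mulr_ge0 ?powR_ge0// ltW.
Qed.

(** The primitive is $-\ln(-\ln t)$. *)
Lemma integral_dlnln (e a : R) : 0 < e -> e < a -> a <= expR (-1) ->
  (\int[lebesgue_measure]_(t in `[e, a]) ((t * - ln t)^-1)%R%:E =
   (ln (- ln e) - ln (- ln a))%:E)%E.
Proof.
move=> e0 ea a1.
have pos t : e <= t -> t <= a -> 0 < t /\ 0 < - ln t.
  move=> et ta; have t0 := lt_le_trans e0 et; split=> //.
  by apply: Nln_gt0; rewrite t0 (le_trans ta).
have dln t : e <= t -> t <= a ->
    is_derive t 1 (fun t => - ln (- ln t)) (t * - ln t)^-1.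
  move=> et ta; have [t0 L0] := pos t et ta.
  have dL : is_derive t 1 (fun t => - ln t) (- t^-1).
    exact: is_deriveN (is_derive1_ln t0).
  have dlnL := @is_derive1_comp _ (@ln R) (fun t => - ln t) t _ _
    (is_derive1_ln L0) dL.
  by apply: is_derive_eq (is_deriveN dlnL) _; rewrite mulrN opprK invfM mulrC.
have cF t : e <= t -> t <= a -> {for t, continuous (fun t => - ln (- ln t))}.
  by move=> et ta; apply: differentiable_continuous; apply/derivable1_diffP;
     apply: (@ex_derive _ _ _ _ _ _ _ (dln t et ta)).
rewrite (@continuous_FTC2 _ (fun t => (t * - ln t)^-1) (fun t => - ln (- ln t)))//.
- by rewrite -EFinB opprK addrC.
- apply: continuous_in_subspaceT => t /set_mem/=; rewrite in_itv/= => /andP[et ta].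
  have [t0 L0] := pos t et ta.
  have cL : {for t, continuous (fun s : R => s * - ln s)}.
    exact: (cvgM cvg_id (cvgN (continuous_ln t0))).
  by apply: (continuousV _ cL); rewrite mulf_neq0// gt_eqF.
- split.
  + move=> t; rewrite in_itv/= => /andP[et ta].
    exact: (@ex_derive _ _ _ _ _ _ _ (dln t (ltW et) (ltW ta))).
  + by apply: cvg_at_right_filter; apply: cF; rewrite ?lexx// ltW.
  + by apply: cvg_at_left_filter; apply: cF; rewrite ?lexx// ltW.
- move=> t; rewrite in_itv/= => /andP[et ta].
  by rewrite derive1E; exact: (@derive_val _ _ _ _ _ _ _ (dln t (ltW et) (ltW ta))).
Qed.

End OneDimensional.

(** * Lower bound on the flux and its weighted integral *)

Lemma ae_le_integral_ge0 d (T : measurableType d) (R : realType)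
    (mu : {measure set T -> \bar R}) (D : set T) (f g : T -> \bar R) :
  measurable D -> measurable_fun D f -> measurable_fun D g ->
  (forall x, D x -> 0 <= g x)%E ->
  {ae mu, forall x, D x -> (f x <= g x)%E} ->
  (\int[mu]_(x in D) f x <= \int[mu]_(x in D) g x)%E.
Proof.
move=> mD mf mg g0 fg.
apply: (@le_trans _ _ (\int[mu]_(x in D) (f^\+ x))%E).
  rewrite integralE; apply: geeDl.
  by rewrite oppe_le0; apply: integral_ge0 => x _; exact: funeneg_ge0.
apply: ae_ge0_le_integral => //; first exact: measurable_funepos.
apply: filterS fg => x fgx Dx.
by rewrite funeposE ge_max fgx//= g0.
Qed.

Section FluxLowerBound.
Variables (R : realType) (p q r a c b gam : R) (Omega : set (R * R)).
Local Notation mu := (@lebesgue_measure R).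
Local Notation plane := (measurableTypeR R * measurableTypeR R)%type.
Local Notation w := (cusp_width r).
Hypotheses (p_gt0 : 0 < p) (r_gt0 : 0 < r) (a_gt0 : 0 < a).
Hypotheses (a_le : a <= expR (-1)) (c_gt0 : 0 < c) (b_ge0 : 0 <= b).
Hypothesis gam_le : gam <= b.
Hypothesis openO : open Omega.
(** Inside the box $[0,a]\times[-a,a]$ the domain is the cusp. *)
Hypothesis OmegaE : forall x y, 0 <= x <= a -> - a <= y <= a ->
  Omega (x, y) <-> 0 < x /\ `|y| < w x.

Variables g1 g2 : R * R -> R.
Hypothesis mg1 : measurable_fun setT (g1 \_ Omega : plane -> R).
Hypothesis mg2 : measurable_fun setT (g2 \_ Omega : plane -> R).
Hypothesis div_ge : {ae @leb2 R, forall z, Omega z ->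
  0 <= z.1 <= a -> - a <= z.2 <= a ->
  c * (z.1 `^ (- 2 / p) * (- ln z.1) `^ (- gam)) <= g1 z + g2 z}.

Variables phi psi : R * R -> R.
Hypotheses (tphi : test_fun Omega phi) (tpsi : test_fun Omega psi).

Let e1 := (g1 \- 'D_(1, 0) phi) \_ Omega.
Let e2 := (g2 \- 'D_(0, 1) psi) \_ Omega.

Lemma measurable_restrict_sub (g F : R * R -> R) :
  measurable_fun setT (g \_ Omega : plane -> R) -> continuous F ->
  measurable_fun setT ((g \- F) \_ Omega : plane -> R).
Proof.
move=> mg cF.
have -> : (g \- F) \_ Omega = (g \_ Omega) \- (F \_ Omega).
  by apply/funext => z; rewrite /= !patchE; case: ifPn => // _; rewrite subr0.
apply: measurable_funB => //.
apply/(measurable_restrictT _ _).1; first exact: open_measurable_plane.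
by apply: measurable_funTS; exact: continuous_measurable_plane.
Qed.

(** The lower bound of the density $g_1 + g_2$ is nonnegative, so the integral
    of the density left of $t$ is at least that over the rectangle
    $]t/2, t[ \times ]-w(t/2), w(t/2)[$, where it is at least a multiple of
    $t^{-2/p} L^{-b}$ by [density_ge].  The divergence of the test functions
    differs from $g_1 + g_2$ by at most $|e_1| + |e_2|$. *)
Lemma flux_ge t : 0 < t <= a ->
  ((c * (2 `^ (- b) * (t `^ (- 2 / p) * (- ln t) `^ (- b)))
     * (t * w (t / 2)))%:E <=
   (2 * w t)%:E * \int[mu]_(y in `[(- a)%R, a]) `|'D_(0%R, 1%R) phi (t, y)|%:E
   + \int[@leb2 R]_(z in `[0%R, a] `*` `[(- a)%R, a]) (`|e1 z| + `|e2 z|)%R%:E)%E.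
Proof.
move=> /andP[t0 ta]; have t1 : 0 < t <= expR (-1) by rewrite t0 (le_trans ta).
have [phiC1 psiC1] := (test_fun_C1 tphi, test_fun_C1 tpsi).
have a1 : 0 < a <= expR (-1) by rewrite a_gt0.
set m := c * _.
have m0 : 0 <= m by rewrite !mulr_ge0 ?powR_ge0// ltW.
have t20 : 0 < t / 2 by rewrite divr_gt0.
have t2t : t / 2 <= t by lra.
have wt2 : 0 < w (t / 2) by rewrite cusp_width_gt0// t20; lra.
have wt2_le : w (t / 2) <= w t by apply: ler_cusp_width => //; lra.
have wt_le : w t <= t by exact: cusp_width_le.
pose S : set plane := `]t / 2, t[ `*` `]- w (t / 2), w (t / 2)[.
pose B : set plane := `[0, t] `*` `[- a, a].
pose Q : set plane := `[0, a] `*` `[- a, a].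
have mS : measurable S by apply: measurableX; exact: measurable_itv.
have mB : measurable B by apply: measurableX; exact: measurable_itv.
have mQ : measurable Q by apply: measurableX; exact: measurable_itv.
have SB : S `<=` B.
  move=> [x y] [/=]; rewrite !in_itv/= => /andP[? ?] /andP[? ?].
  by split; rewrite /= in_itv/=; apply/andP; split; lra.
have BQ : B `<=` Q by move=> [x y] [/=]; rewrite !in_itv/= => /andP[? ?] ?;
  split; rewrite //= in_itv/=; apply/andP; split; lra.
have muS : @leb2 R S = (t * w (t / 2))%:E.
  by rewrite leb2_box; [congr EFin; field|lra|lra].
pose d z := 'D_(1, 0) phi z + 'D_(0, 1) psi z.
have [_ _ _ cdphi _] := phiC1; have [_ _ _ _ cdpsi] := psiC1.
have md : measurable_fun setT (d : plane -> R).
  by apply: measurable_funD; exact: continuous_measurable_plane.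
have mE : measurable_fun setT (fun z : plane => (`|e1 z| + `|e2 z|)%:E).
  apply/measurable_EFinP; apply: measurable_funD;
    by apply: measurableT_comp => //; exact: measurable_restrict_sub.
have iD : (@leb2 R).-integrable B (EFin \o d).
  have := integrableD mB (@integrable_box R _ 0 t (- a) a cdphi)
    (@integrable_box R _ 0 t (- a) a cdpsi).
  by apply: eq_integrable => // z _; rewrite /= EFinD.
have iS : (@leb2 R).-integrable B (EFin \o (fun z => m * \1_S z)).
  apply: measurable_bounded_integrable => //.
  - by rewrite leb2_box ?ltry//; lra.
  - by apply: measurable_funM => //; apply: measurable_indic.
  - exists m; split; first exact: num_real.
    move=> x mx z _; rewrite /= indicE normrM (ger0_norm m0).
    case: (z \in S); rewrite ?normr1 ?normr0 ?mulr0 ?mulr1 ltW//.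
    exact: le_lt_trans mx.
(* The divergence of the test functions has no sign, so it is first subtracted
   from the lower bound: the difference is below the nonnegative error. *)
have -> : ((m * (t * w (t / 2)))%:E =
    \int[@leb2 R]_(z in B) (m * \1_S z)%R%:E)%E.
  under eq_integral do rewrite EFinM.
  rewrite ge0_integralZl//; last first.
    by apply/measurable_EFinP; apply: measurable_indic.
  by rewrite integral_indic// setIidl// muS.
have <- : (\int[@leb2 R]_(z in B) (m * \1_S z - d z)%R%:E +
    \int[@leb2 R]_(z in B) (d z)%:E =
    \int[@leb2 R]_(z in B) (m * \1_S z)%R%:E)%E.
  rewrite integralB_EFin// subeK//; exact: integrable_fin_num.
rewrite addeC; apply: leeD.
  have top_out x : 0 <= x <= t -> ~ (0 < x /\ a < w x).
    move=> /andP[_ xt] [x0 aw]; suff : w x <= a by rewrite leNgt aw.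
    apply: (@le_trans _ _ x); last by lra.
    by apply: cusp_width_le => //; rewrite x0 (le_trans xt)// (le_trans ta).
  have a_in : - a <= - a <= a by apply/andP; split; lra.
  have a_in' : - a <= a <= a by apply/andP; split; lra.
  have xa x : 0 <= x <= t -> 0 <= x <= a by move=> /andP[-> /= /le_trans]; apply.
  apply: flux_le => //; [exact: ltW|exact: ltW|by rewrite ltW// cusp_width_gt0|..].
  - move=> y ya; apply: (test_fun_out tphi) => /(OmegaE _ ya)[].
      by rewrite lexx ltW.
    by rewrite ltxx.
  - move=> y ya wy; apply: (test_fun_out tphi) => /(OmegaE _ ya)[].
      by rewrite ltW.
    by move=> _; rewrite ltNge wy.
  - exact: le_trans ta.
  - move=> x xt; apply: (test_fun_out tpsi) => /(OmegaE (xa _ xt) a_in).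
    by rewrite normrN (gtr0_norm a_gt0); exact: top_out.
  - move=> x xt; apply: (test_fun_out tpsi) => /(OmegaE (xa _ xt) a_in').
    by rewrite (gtr0_norm a_gt0); exact: top_out.
apply: (@le_trans _ _ (\int[@leb2 R]_(z in B) (`|e1 z| + `|e2 z|)%R%:E)%E).
  apply: ae_le_integral_ge0 => //.
  - apply/measurable_EFinP; apply: measurable_funTS.
    apply: measurable_funB => //; apply: measurable_funM => //.
  - exact: measurable_funTS.
  have aeF : Filter (almost_everywhere (@leb2 R)) by exact: ae_filter_ringOfSetsType.
  apply: filterS div_ge => -[x y] h [/=]; rewrite !in_itv/= => xt ya.
  have xa : 0 <= x <= a by case/andP: xt => -> /= /le_trans; apply.
  have [zO|zO] := pselect (Omega (x, y)); last first.
    rewrite /d (derive_test_fun_out tphi _ zO) (derive_test_fun_out tpsi _ zO).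
    rewrite lee_fin indicE memNset ?mulr0 ?addr0 ?subr0 ?addr_ge0//.
    move=> [/=]; rewrite !in_itv/= => /andP[tx xt'] yw; apply: zO.
    apply/(OmegaE xa ya); split; first exact: lt_trans tx.
    rewrite ltr_norml; case/andP: yw => wy yw.
    have : w (t / 2) <= w x by apply: ler_cusp_width => //; lra.
    by move=> ?; apply/andP; split; lra.
  have := h zO xa ya; rewrite /=; set rho := c * _ => rho_le.
  have rho0 : 0 <= rho by rewrite !mulr_ge0 ?powR_ge0// ltW.
  have mrho : m * \1_S (x, y) <= rho.
    rewrite indicE; case: (boolP (_ \in S)) => [/set_mem[/=]|_]; last by rewrite mulr0.
    rewrite !in_itv/= => /andP[tx xt'] _; rewrite mulr1 ler_wpM2l ?(ltW c_gt0)//.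
    by apply: density_ge => //; exact: ltW.
  rewrite lee_fin /e1 /e2 /d !patchE !mem_set//=.
  apply: (@le_trans _ _ (g1 (x, y) - 'D_(1, 0) phi (x, y) +
    (g2 (x, y) - 'D_(0, 1) psi (x, y)))); first by lra.
  by apply: lerD; exact: ler_norm.
by apply: ge0_subset_integral => //; exact: measurable_funTS.
Qed.


(** From here on the flux bound is multiplied by $\sigma / w$ and integrated
    over $[e, a]$.  The constant $G$ bounds the weights there and may depend on
    $e$; [eta] bounds the errors made by replacing $g_1$, $g_2$, $g_3$, which
    stand for $\partial_x u_1$, $\partial_y u_2$, $\partial_y u_1$, with the
    derivatives of the test functions. *)
Hypotheses (q_gt0 : 0 < q) (pq : p^-1 + q^-1 = 1).
Hypothesis bE : b = p^-1 + r / q.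

Variable g3 : R * R -> R.
Hypothesis mg3 : measurable_fun setT (g3 \_ Omega : plane -> R).

Let e3 := (g3 \- 'D_(0, 1) phi) \_ Omega.
Local Notation sigma := (flux_weight r q).
Local Notation kappa := (c * 2 `^ (- b) * (2 `^ (- r) / 2)).

Variables e G l V eta : R.
Hypotheses (e_gt0 : 0 < e) (ea : e < a) (G_ge0 : 0 <= G) (l_gt0 : 0 < l).
Hypothesis eta_ge0 : 0 <= eta.
Hypothesis sigma_le : forall t, e <= t <= a -> sigma t <= G.
Hypothesis sigma_w_le : forall t, e <= t <= a -> sigma t / w t <= G.
Hypothesis g3_le : (\int[@leb2 R]_z (`|(g3 \_ Omega) z| `^ p)%:E <= V%:E)%E.
Let Q : set plane := `[0, a] `*` `[- a, a].
Hypothesis e1_le : (\int[@leb2 R]_(z in Q) `|e1 z|%:E <= eta%:E)%E.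
Hypothesis e2_le : (\int[@leb2 R]_(z in Q) `|e2 z|%:E <= eta%:E)%E.
Hypothesis e3_le : (\int[@leb2 R]_(z in Q) `|e3 z|%:E <= eta%:E)%E.

Let S t := (\int[mu]_(y in `[(- a)%R, a]) `|'D_(0%R, 1%R) phi (t, y)|%:E)%E.

Let S_ge0 t : (0 <= S t)%E.
Proof. exact: integral_ge0. Qed.

Let mQ : measurable Q.
Proof. by apply: measurableX; exact: measurable_itv. Qed.

Let in_cusp_range t : e <= t -> t <= a -> 0 < t <= expR (-1).
Proof. by move=> et ta; rewrite (lt_le_trans e_gt0)// (le_trans ta). Qed.

Lemma weighted_flux_ge t : e <= t <= a ->
  ((kappa * (t * - ln t)^-1)%:E <=
   (2 * sigma t)%:E * S t + (2 * G * eta)%:E)%E.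
Proof.
move=> eta_t; have [et ta] := andP eta_t.
have t1 := in_cusp_range et ta; have [t0 _] := andP t1.
have w0 := cusp_width_gt0 r t1.
have s0 : 0 <= sigma t / w t by rewrite divr_ge0 ?flux_weight_ge0// ltW.
have := @flux_ge t; rewrite t0 ta => /(_ isT) h.
have [_ _ _ cdphi _] := test_fun_C1 tphi; have [_ _ _ _ cdpsi] := test_fun_C1 tpsi.
have E_le : (\int[@leb2 R]_(z in Q) (`|e1 z| + `|e2 z|)%R%:E <= (2 * eta)%R%:E)%E.
  under eq_integral do rewrite EFinD.
  rewrite ge0_integralD//; last 2 first.
  - apply/measurable_EFinP; apply: measurable_funTS.
    by apply: measurableT_comp => //; exact: measurable_restrict_sub.
  - apply/measurable_EFinP; apply: measurable_funTS.
    by apply: measurableT_comp => //; exact: measurable_restrict_sub.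
  rewrite (_ : (2 * eta)%R = (eta + eta)%R); last by rewrite mulr2n mulrDl !mul1r.
  by rewrite EFinD; apply: leeD; [exact: e1_le|exact: e2_le].
have {h E_le} := le_trans h (leeD2l _ E_le).
have s0' : (0 <= (sigma t / w t)%:E)%E by rewrite lee_fin.
move=> /(lee_wpmul2l s0'); rewrite -EFinM ge0_muleDr; last 2 first.
- by apply: mule_ge0; [rewrite lee_fin mulr_ge0// ltW|exact: S_ge0].
- by rewrite lee_fin mulr_ge0.
rewrite muleA -!EFinM => h; apply: le_trans (le_trans _ h) _.
  rewrite lee_fin -(density_flux_weight r pq t1) -bE.
  have wh := cusp_width_half r_gt0 t1.
  set X := t `^ _ * _; have X0 : 0 <= X by rewrite mulr_ge0 ?powR_ge0.
  apply: (@le_trans _ _ (sigma t / w t *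
      (c * (2 `^ (- b) * X) * (t * (2 `^ (- r) / 2 * w t))))).
    by rewrite le_eqVlt; apply/orP; left; apply/eqP; field; rewrite gt_eqF.
  by rewrite ler_wpM2l// ler_wpM2l ?mulr_ge0 ?powR_ge0 ?(ltW c_gt0)// ler_wpM2l// ltW.
rewrite (_ : sigma t / w t * (2 * w t) = 2 * sigma t); last first.
  by field; rewrite gt_eqF.
apply: leeD2l; rewrite lee_fin (_ : 2 * G * eta = G * (2 * eta)); last by ring.
by rewrite ler_wpM2r ?mulr_ge0// sigma_w_le.
Qed.

Let D01 := 'D_(0, 1) phi.

Let measurable_D01 : measurable_fun setT (fun z : plane => `|D01 z|).
Proof.
apply: measurableT_comp => //; apply: continuous_measurable_plane.
by case: (test_fun_C1 tphi).
Qed.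

Let measurable_S : measurable_fun setT S.
Proof.
apply: (@measurable_fun_vintegral R `[- a, a]%classic (fun z => `|D01 z|%:E)) => //.
exact/measurable_EFinP.
Qed.

Let measurable_sigma D : measurable_fun D sigma.
Proof. by apply: measurable_funTS; exact: measurable_flux_weight. Qed.

Let measurable_2sigma D : measurable_fun D (fun t => (2 * sigma t)%:E).
Proof. by apply/measurable_EFinP; exact: measurable_funM. Qed.

Let T : set (measurableTypeR R) := `[e, a].
Let Te t : T t -> e <= t <= a.
Proof. by rewrite /T/= in_itv. Qed.
Let mT : measurable T. Proof. exact: measurable_itv. Qed.
Let J : set (measurableTypeR R) := `[- a, a].
Let mJ : measurable J. Proof. exact: measurable_itv. Qed.

Let mTJ : measurable (T `*` J).
Proof. exact: measurableX. Qed.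

Let TJQ : T `*` J `<=` Q.
Proof.
move=> [x y] [/=]; rewrite /T /J /= !in_itv/= => /andP[ex xa] yJ.
by split; rewrite /= in_itv//= xa andbT (le_trans _ ex)// ltW.
Qed.

Local Notation I := (ln (- ln e) - ln (- ln a)).

(* On $[e, a]$ the function $1/(t L)$ coincides with $\sigma^q w$. *)
Let measurable_inv_tL : measurable_fun T (fun t : R => (t * - ln t)^-1).
Proof.
apply: (@eq_measurable_fun _ _ _ _ _ (fun t => sigma t `^ q * w t)) => [t|].
  move=> /set_mem/Te/andP[et ta].
  by rewrite (flux_weight_width r q_gt0 (in_cusp_range et ta)).
apply: measurable_funM.
  by apply: (measurableT_comp (@measurable_powR R q)); exact: measurable_sigma.
by apply: measurable_funTS; exact: measurable_cusp_width.
Qed.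

Let inv_tL_ge0 t : T t -> 0 <= (t * - ln t)^-1.
Proof.
move=> /Te/andP[et ta]; have t1 := in_cusp_range et ta.
by rewrite invr_ge0 mulr_ge0 ?ltW ?(Nln_gt0 t1)//; case/andP: t1.
Qed.

Let integral_inv_tL k : 0 <= k ->
  (\int[mu]_(t in T) (k * (t * - ln t)^-1)%R%:E = (k * I)%R%:E)%E.
Proof.
move=> k0; under eq_integral do rewrite EFinM.
rewrite ge0_integralZl//.
- by rewrite integral_dlnln.
- by apply/measurable_EFinP.
Qed.

(** The slice of the cusp at abscissa $t$ has length $2w(t)$. *)
Let slice_le t k : 0 <= k -> T t ->
  (\int[mu]_(y in J) (k * \1_Omega (t, y))%R%:E <= (2 * (k * w t))%R%:E)%E.
Proof.
move=> k0 Tt; have /andP[et ta] := Te Tt.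
have t1 := in_cusp_range et ta; have [t0 _] := andP t1.
have w0 := cusp_width_gt0 r t1.
pose W : set (measurableTypeR R) := [set` `]- w t, w t[].
have mW : measurable W by exact: measurable_itv.
apply: (@le_trans _ _ (\int[mu]_(y in J) (k%:E * (\1_W y)%:E))%E).
  apply: ge0_le_integral => //.
  - by move=> y _; rewrite lee_fin mulr_ge0.
  - apply/measurable_EFinP; apply: measurable_funM => //.
    apply: measurable_funTS.
    apply: (@measurableT_comp _ _ _ _ _ _ (\1_Omega : plane -> R)).
      by apply: measurable_indic; exact: open_measurable_plane.
    exact: pair1_measurable.
  - by apply: measurable_funeM; apply/measurable_EFinP; exact: measurable_indic.
  - move=> y Jy; rewrite -EFinM lee_fin ler_wpM2l// !indicE.
    case: (boolP ((t, y) \in _)) => // /set_mem.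
    move=> /(OmegaE _ _)[]; [by rewrite ta ltW| |].
      by move: Jy; rewrite /J/= in_itv.
    by move=> _; rewrite ltr_norml => yw; rewrite mem_set// /W/= in_itv.
rewrite ge0_integralZl//; last by apply/measurable_EFinP; exact: measurable_indic.
rewrite integral_indic// -/J (_ : 2 * (k * w t) = k * (2 * w t)); last by ring.
rewrite EFinM; apply: lee_wpmul2l; first by rewrite lee_fin.
apply: (@le_trans _ _ (mu W)).
  by apply: le_measure; rewrite ?inE//; exact: measurableI.
rewrite lebesgue_measure_itv/=; case: ifPn => _.
  by rewrite -EFinB lee_fin; lra.
by rewrite lee_fin mulr_ge0// ltW.
Qed.

Let C := l `^ (- p / q).
Let C_ge0 : 0 <= C. Proof. exact: powR_ge0. Qed.

(** Young's inequality is applied to $g_3$, whose $L^p$ norm does not depend on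
    the test function; the distance of the derivative of the test function to
    $g_3$ is kept to the first power, with the crude bound [G] for the
    weight. *)
Let weighted_derivative_le z : (T `*` J) z ->
  2 * sigma z.1 * `|D01 z| <=
  2 * l * sigma z.1 `^ q * \1_Omega z +
  (2 * C * `|(g3 \_ Omega) z| `^ p + 2 * G * `|e3 z|).
Proof.
move=> [Tz Jz]; have s0 := flux_weight_ge0 r q z.1.
have sG := sigma_le (Te Tz).
have [zO|zO] := pselect (Omega z); last first.
  by rewrite /D01 (derive_test_fun_out tphi _ zO) normr0 mulr0
    !addr_ge0 ?mulr_ge0 ?powR_ge0// ltW.
rewrite indicE mem_set// mulr1 /e3 !patchE !mem_set//=.
have := young_weighted p_gt0 q_gt0 pq l_gt0 s0 (normr_ge0 (g3 z)).
rewrite -/C => young.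
have : `|D01 z| <= `|g3 z| + `|g3 z - D01 z|.
  by rewrite -[X in `|X| <= _](subKr (g3 z)) ler_normB.
move=> /(ler_wpM2l s0) tri.
have := ler_wpM2r (normr_ge0 (g3 z - D01 z)) sG.
rewrite /D01 in tri *; lra.
Qed.

(** The term [4 * l * I] is absorbed in the left-hand side when [l] is small
    compared with [kappa]; [V] does not depend on [e], and [eta] can be chosen
    after [G]. *)
Lemma weighted_flux_le :
  kappa * I <= 4 * l * I + 2 * C * V + 4 * G * eta.
Proof.
have [_ _ _ _ cD01] := test_fun_C1 tphi.
have k0 : 0 <= kappa by rewrite !mulr_ge0 ?powR_ge0// ltW.
have a1 : a - e <= 1.
  have : expR (-1) <= 1 :> R by rewrite -[leRHS]expR0 ler_expR.
  by move: a_le e_gt0; lra.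
have step1 : ((kappa * I)%:E <=
    \int[mu]_(t in T) ((2 * sigma t)%:E * S t) + (2 * G * eta)%:E)%E.
  rewrite -integral_inv_tL//.
  apply: (@le_trans _ _ (\int[mu]_(t in T)
      ((2 * sigma t)%:E * S t + (2 * G * eta)%:E))%E).
    apply: ge0_le_integral => //.
    - by move=> t Tt; rewrite lee_fin mulr_ge0// inv_tL_ge0.
    - by apply/measurable_EFinP; exact: measurable_funM.
    - apply: emeasurable_funD => //; apply: emeasurable_funM.
        exact: measurable_2sigma.
      by apply: measurable_funTS; exact: measurable_S.
    - by move=> t /Te; exact: weighted_flux_ge.
  rewrite ge0_integralD//.
  - have muT : mu T = (a - e)%:E.
      by rewrite /T lebesgue_measure_itv/= lte_fin ea -EFinB.
    apply: leeD2l; rewrite integral_cst// [X in (_ * X)%E]muT.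
    by rewrite -EFinM lee_fin ler_piMr// !mulr_ge0.
  - by move=> t _; rewrite mule_ge0// lee_fin mulr_ge0// flux_weight_ge0.
  - apply: emeasurable_funM; last by apply: measurable_funTS; exact: measurable_S.
    exact: measurable_2sigma.
  - by move=> t _; rewrite lee_fin !mulr_ge0.
have me3 : measurable_fun setT (fun z : plane => `|e3 z|).
  by apply: measurableT_comp => //; exact: measurable_restrict_sub.
have ms1 : measurable_fun setT (fun z : plane => sigma z.1).
  by apply: (@measurableT_comp _ _ _ _ _ _ (flux_weight r q)).
have mO : measurable_fun setT (\1_Omega : plane -> R).
  by apply: measurable_indic; exact: open_measurable_plane.
have mg3p : measurable_fun setT (fun z : plane => `|(g3 \_ Omega) z| `^ p).
  apply: (measurableT_comp (@measurable_powR R p)).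
  exact: measurableT_comp.
have msq : measurable_fun setT (fun z : plane => 2 * l * sigma z.1 `^ q * \1_Omega z).
  apply: measurable_funM => //; apply: measurable_funM => //.
  exact: (measurableT_comp (@measurable_powR R q)).
have step2 : (\int[mu]_(t in T) ((2 * sigma t)%:E * S t) =
    \int[@leb2 R]_(z in T `*` J) (2 * sigma z.1 * `|D01 z|)%R%:E)%E.
  rewrite (@tonelli_setX R T J (fun z => (2 * sigma z.1 * `|D01 z|)%R%:E))//.
  - apply: eq_integral => t _ /=; under [RHS]eq_integral do rewrite EFinM.
    rewrite ge0_integralZl//.
    + apply: measurable_funTS; apply/measurable_EFinP.
      exact: (measurableT_comp measurable_D01 (pair1_measurable _)).
    + by rewrite lee_fin mulr_ge0// flux_weight_ge0.
  - by move=> z; rewrite lee_fin mulr_ge0// mulr_ge0// flux_weight_ge0.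
  - apply/measurable_EFinP; apply: measurable_funM; last exact: measurable_D01.
    exact: measurable_funM.
have step3 : (\int[@leb2 R]_(z in T `*` J)
    (2 * l * sigma z.1 `^ q * \1_Omega z)%R%:E <= (4 * l * I)%:E)%E.
  rewrite (@tonelli_setX R T J (fun z => (2 * l * sigma z.1 `^ q * \1_Omega z)%R%:E))//.
  - rewrite -integral_inv_tL; last by rewrite mulr_ge0// ltW.
    apply: ge0_le_integral => //.
    + by move=> t _; apply: integral_ge0 => y _; rewrite lee_fin !mulr_ge0 ?powR_ge0// ltW.
    + apply: measurable_funTS.
      apply: (@measurable_fun_vintegral R J
        (fun z => (2 * l * sigma z.1 `^ q * \1_Omega z)%R%:E)) => //.
        by move=> z; rewrite lee_fin !mulr_ge0 ?powR_ge0// ltW.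
      exact/measurable_EFinP.
    + by apply/measurable_EFinP; exact: measurable_funM.
    + move=> t Tt /=; have /andP[et ta] := Te Tt.
      apply: le_trans (slice_le _ Tt) _.
        by rewrite !mulr_ge0 ?powR_ge0// ltW.
      rewrite -(flux_weight_width r q_gt0 (in_cusp_range et ta)).
      by rewrite lee_fin le_eqVlt; apply/orP; left; apply/eqP; ring.
  - by move=> z; rewrite lee_fin !mulr_ge0 ?powR_ge0// ltW.
  - exact/measurable_EFinP.
have step4 : (\int[@leb2 R]_(z in T `*` J)
    (2 * C * `|(g3 \_ Omega) z| `^ p)%R%:E <= (2 * C * V)%:E)%E.
  have C2 : (0 <= (2 * C)%:E)%E by rewrite lee_fin mulr_ge0.
  apply: (@le_trans _ _
      (\int[@leb2 R]_z (2 * C * `|(g3 \_ Omega) z| `^ p)%R%:E)%E).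
    apply: ge0_subset_integral => //.
    - by apply/measurable_EFinP; exact: measurable_funM.
    - by move=> z _; rewrite lee_fin !mulr_ge0 ?powR_ge0.
  under eq_integral do rewrite EFinM.
  rewrite ge0_integralZl//; last exact/measurable_EFinP.
  by rewrite (EFinM (2 * C)); exact: lee_wpmul2l.
have step5 : (\int[@leb2 R]_(z in T `*` J)
    (2 * G * `|e3 z|)%R%:E <= (2 * G * eta)%:E)%E.
  have G2 : (0 <= (2 * G)%:E)%E by rewrite lee_fin mulr_ge0.
  apply: (@le_trans _ _ (\int[@leb2 R]_(z in Q) (2 * G * `|e3 z|)%R%:E)%E).
    apply: ge0_subset_integral => //.
    - apply: measurable_funTS; apply/measurable_EFinP; exact: measurable_funM.
    - by move=> z _; rewrite lee_fin !mulr_ge0.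
  under eq_integral do rewrite EFinM.
  rewrite ge0_integralZl//; last first.
  - by apply: measurable_funTS; exact/measurable_EFinP.
  by rewrite (EFinM (2 * G)); exact: lee_wpmul2l.
rewrite -lee_fin; apply: le_trans step1 _.
have -> : (4 * l * I + 2 * C * V + 4 * G * eta =
    (4 * l * I + (2 * C * V + 2 * G * eta)) + 2 * G * eta) by ring.
rewrite (EFinD (_ + _) (2 * G * eta)); apply: leeD2r; rewrite step2.
apply: (@le_trans _ _ (\int[@leb2 R]_(z in T `*` J)
  ((2 * l * sigma z.1 `^ q * \1_Omega z)%R%:E +
   ((2 * C * `|(g3 \_ Omega) z| `^ p)%R%:E + (2 * G * `|e3 z|)%R%:E)))%E).
  apply: ge0_le_integral => //.
  - by move=> z _; rewrite lee_fin mulr_ge0// mulr_ge0// flux_weight_ge0.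
  - apply: measurable_funTS; apply/measurable_EFinP.
    apply: measurable_funM; last exact: measurable_D01.
    exact: measurable_funM.
  - apply: measurable_funTS; apply: emeasurable_funD; first exact/measurable_EFinP.
    by apply: emeasurable_funD; apply/measurable_EFinP; exact: measurable_funM.
rewrite ge0_integralD//; last 4 first.
- by move=> z _; rewrite lee_fin !mulr_ge0 ?powR_ge0// ltW.
- by apply: measurable_funTS; exact/measurable_EFinP.
- by move=> z _; rewrite adde_ge0// lee_fin !mulr_ge0 ?powR_ge0.
- apply: measurable_funTS.
  by apply: emeasurable_funD; apply/measurable_EFinP; exact: measurable_funM.
rewrite ge0_integralD//; last 4 first.
- by move=> z _; rewrite lee_fin !mulr_ge0 ?powR_ge0.
- by apply: measurable_funTS; apply/measurable_EFinP; exact: measurable_funM.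
- by move=> z _; rewrite lee_fin !mulr_ge0.
- by apply: measurable_funTS; apply/measurable_EFinP; exact: measurable_funM.
by rewrite !EFinD; apply: leeD => //; exact: leeD.
Qed.

End FluxLowerBound.

(** * Lebesgue norms *)

Section Lp.
Variables (R : realType) (Omega : set (R * R)) (p : R).
Hypothesis p_gt1 : 1 < p.
Local Notation plane := (measurableTypeR R * measurableTypeR R)%type.

Lemma in_Lp_measurable h : in_Lp Omega p h ->
  measurable_fun setT (h \_ Omega : plane -> R).
Proof. by move=> /sub_Lfun_mfun; rewrite inE. Qed.

Lemma in_Lp_integral_powR h : in_Lp Omega p h -> exists2 V, 0 <= V &
  (\int[@leb2 R]_z (`|(h \_ Omega) z| `^ p)%:E <= V%:E)%E.
Proof.
move=> /sub_Lfun_finLfun; rewrite inE /= /finite_norm => Nlt.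
have p0 : p != 0 by rewrite gt_eqF// (lt_trans ltr01).
have intE := @powR_Lnorm _ _ R (@leb2 R) (EFin \o h \_ Omega) _ p0.
have int_lty : (\int[@leb2 R]_z (`|(h \_ Omega) z| `^ p)%:E < +oo)%E.
  by rewrite -intE poweR_lty.
have int0 : (0 <= \int[@leb2 R]_z (`|(h \_ Omega) z| `^ p)%:E)%E.
  by apply: integral_ge0 => z _; rewrite lee_fin powR_ge0.
exists (fine (\int[@leb2 R]_z (`|(h \_ Omega) z| `^ p)%:E)%E).
  exact: fine_ge0.
by rewrite fineK// ge0_fin_numE.
Qed.

(** Hoelder's inequality against the indicator of [Q], whose norm is at most
    $1$. *)
Lemma L1_le_Lp_norm h (Q : set plane) (eta : R) : measurable Q ->
  (@leb2 R Q <= 1)%E -> measurable_fun setT (h \_ Omega : plane -> R) ->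
  (Lp_norm Omega p h <= eta%:E)%E ->
  (\int[@leb2 R]_(z in Q) `|(h \_ Omega) z|%:E <= eta%:E)%E.
Proof.
move=> mQ Q1 mh heta; have p0 : 0 < p by exact: lt_trans p_gt1.
have ip1 : p^-1 < 1 by rewrite invf_lt1.
have q0 : 0 < (1 - p^-1)^-1 by rewrite invr_gt0 subr_gt0.
have m1 : measurable_fun setT (\1_Q : plane -> R) by exact: measurable_indic.
have := @hoelder _ _ _ (@leb2 R) (h \_ Omega) (\1_Q) p _ mh m1 p0 q0.
rewrite invrK addrC subrK => /(_ erefl) hold.
have -> : (\int[@leb2 R]_(z in Q) `|(h \_ Omega) z|%:E =
    'N[@leb2 R]_1[EFin \o ((h \_ Omega) \* \1_Q)%R])%E.
  rewrite Lnorm1 [LHS]integral_mkcond; apply: eq_integral => z _ /=.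
  rewrite patchE indicE; case: (z \in Q); first by rewrite mulr1.
  by rewrite mulr0 normr0.
apply: le_trans hold _.
have N1 : ('N[@leb2 R]_(((1 - p^-1)^-1)%R%:E)[EFin \o \1_Q] <= 1)%E.
  rewrite unlock.
  have -> : (\int[@leb2 R]_x (`|(EFin \o \1_Q) x| `^ (1 - p^-1)^-1) = @leb2 R Q)%E.
    rewrite -[in RHS](setIT Q) -integral_indic//; apply: eq_integral => z _ /=.
    rewrite indicE; case: (z \in Q).
      by rewrite normr1 powR1.
    by rewrite normr0 powR0// gt_eqF.
  rewrite invrK -(poweR1r (1 - p^-1)).
  apply: gt0_ler_poweR => //; rewrite ?in_itv/= ?leey ?andbT//.
  by rewrite subr_ge0 ltW.
apply: le_trans (_ : (Lp_norm Omega p h * 1 <= _)%E).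
  by apply: lee_wpmul2l => //; exact: Lnorm_ge0.
by rewrite mule1.
Qed.

Lemma W1p_dist_lt (u : W1p Omega p) phi (eta : R) : (W1p_dist u phi < eta%:E)%E ->
  (Lp_norm Omega p (W1p_dx u \- 'D_(1, 0) phi)%R <= eta%:E)%E /\
  (Lp_norm Omega p (W1p_dy u \- 'D_(0, 1) phi)%R <= eta%:E)%E.
Proof.
move=> /ltW h; split; apply: le_trans h.
  apply: (@le_trans _ _ (Lp_norm Omega p (u \- phi)%R +
    Lp_norm Omega p (W1p_dx u \- 'D_(1, 0) phi)%R)%E).
    by apply: leeDr; exact: Lnorm_ge0.
  by apply: leeDl; exact: Lnorm_ge0.
by apply: leeDr; apply: adde_ge0; exact: Lnorm_ge0.
Qed.

End Lp.

(** * Nonexistence of a solution *)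

Lemma box_sub_eball0 (R : realType) (a d x y : R) : 0 < a -> 2 * a <= d ->
  0 <= x <= a -> - a <= y <= a -> eball0 d (x, y).
Proof.
move=> a0 ad /andP[x0 xa] /andP[ay ya]; rewrite /eball0 /=.
apply: lt_le_trans ad.
rewrite -[ltRHS]ger0_norm ?mulr_ge0 ?ltW// -sqrtr_sqr ltr_sqrt; last first.
  by rewrite exprn_gt0// mulr_gt0.
nra.
Qed.

Theorem mainTheorem2 (R : realType) (p r : R) (Omega : set (R * R)%type)
    (alpha : R) (f : R * R -> R) :
  1 < p -> 0 < r ->
  bounded_domain Omega ->
  (exists2 delta : R, 0 < delta < 1 &
    Omega `&` eball0 delta = @log_cusp R r `&` eball0 delta) ->
  - r / p < alpha <= - r / p + r ->
  in_Lp_mean0 Omega p f ->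
  sim0 Omega f (fun x => x `^ (- 2 / p) * (- ln x) `^ (- 1 / p - alpha)) ->
  ~ exists u : W1p Omega p * W1p Omega p,
      [/\ in_W1p0 u.1, in_W1p0 u.2 &
          {ae @leb2 R, forall z, Omega z -> div2 u z = f z}].
Proof.
move=> p1 r0 [openO _ _ _] [d /andP[d0 d1] OmegaB] /andP[_ alpha_le] _.
move=> [c0 c0_gt0 simf] [[u1 u2] [/= u1_0 u2_0 divu]].
have p0 : 0 < p by exact: lt_trans p1.
pose q := (1 - p^-1)^-1.
have ip1 : p^-1 < 1 by rewrite invf_lt1.
have q0 : 0 < q by rewrite invr_gt0 subr_gt0.
have pq : p^-1 + q^-1 = 1 by rewrite invrK addrC subrK.
pose b := p^-1 + r / q.
have b0 : 0 <= b.
  by apply: addr_ge0; [rewrite invr_ge0 ltW|apply: divr_ge0; exact: ltW].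
have gam_le : p^-1 + alpha <= b.
  rewrite lerD2l (le_trans alpha_le)//.
  by rewrite /q invrK le_eqVlt; apply/orP; left; apply/eqP; ring.
have c_gt0 : 0 < c0 / 2 by rewrite divr_gt0.
have [eta0 eta0_gt0 {}simf] := simf _ c_gt0.
have [a [a0 ad aeta a1 a2]] : exists a : R,
    [/\ 0 < a, 2 * a <= d, 2 * a <= eta0, a <= expR (-1) & a <= 1 / 2].
  exists (Num.min (Num.min (d / 2) (eta0 / 2)) (Num.min (expR (-1)) (1 / 2))).
  have e1 := expR_gt0 (-1 : R).
  split; first by rewrite !lt_min !divr_gt0// e1.
  - by rewrite mulrC -ler_pdivlMr// !ge_min lexx.
  - by rewrite mulrC -ler_pdivlMr// !ge_min lexx !orbT.
  - by rewrite !ge_min lexx !orbT.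
  - by rewrite !ge_min lexx !orbT.
have aa1 : a * (a + a) <= 1 by clear -a0 a2; nra.
have OmegaE x y : 0 <= x <= a -> - a <= y <= a ->
    Omega (x, y) <-> 0 < x /\ `|y| < cusp_width r x.
  move=> xa ya; have B := box_sub_eball0 a0 ad xa ya.
  have : (Omega `&` eball0 d) (x, y) <-> (log_cusp r `&` eball0 d) (x, y).
    by rewrite OmegaB.
  move=> [h1 h2]; split=> [Oxy|[x0 yw]].
    by have [[/andP[? _] ?] _] := h1 (conj Oxy B).
  apply: (h2 _).1; split => //; split => //=.
  by rewrite x0/=; case/andP: xa => _ /le_lt_trans; apply; lra.
have aeF : Filter (almost_everywhere (@leb2 R)) by exact: ae_filter_ringOfSetsType.
have div_ge : {ae @leb2 R, forall z, Omega z ->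
    0 <= z.1 <= a -> - a <= z.2 <= a ->
    c0 / 2 * (z.1 `^ (- 2 / p) * (- ln z.1) `^ (- (p^-1 + alpha))) <=
    W1p_dx u1 z + W1p_dy u2 z}.
  (* The relative error c0 / 2 leaves half of the limit c0 of f / psi. *)
  apply: filterS2 divu simf => -[x y] /= divE simE Oxy xa ya.
  have -> : W1p_dx u1 (x, y) + W1p_dy u2 (x, y) = f (x, y) by exact: divE.
  have [x0 _] := (OmegaE _ _ xa ya).1 Oxy.
  have x1 : 0 < x <= expR (-1).
    by rewrite x0 (le_trans _ a1)//; case/andP: xa.
  rewrite (_ : - (p^-1 + alpha) = - 1 / p - alpha); last by ring.
  set psi := x `^ _ * _ in simE *.
  have psi0 : 0 < psi by rewrite mulr_gt0// powR_gt0// Nln_gt0.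
  have := simE (conj Oxy (box_sub_eball0 a0 aeta xa ya)).
  rewrite ler_norml => /andP[+ _]; rewrite -ler_pdivlMr//; lra.
have mdx (u : W1p Omega p) := in_Lp_measurable (W1p_dx_Lp u).
have mdy (u : W1p Omega p) := in_Lp_measurable (W1p_dy_Lp u).
have [V V0 V_le] := in_Lp_integral_powR p1 (W1p_dy_Lp u1).
pose kappa := c0 / 2 * 2 `^ (- b) * (2 `^ (- r) / 2).
have kappa0 : 0 < kappa by rewrite !mulr_gt0 ?powR_gt0.
pose l := kappa / 8.
have l0 : 0 < l by rewrite divr_gt0.
pose C := l `^ (- p / q).
have CV0 : 0 <= C * V by rewrite mulr_ge0 ?powR_ge0.
(* With this M and l the conclusion of weighted_flux_le would read
   2 C V + 2 <= 2 C V + 1. *)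
pose M := (2 * C * V + 2) / (kappa / 2).
have M0 : 0 < M by rewrite divr_gt0 ?divr_gt0//; lra.
have La0 : 0 < - ln a by apply: Nln_gt0; rewrite a0.
(* The cut-off making the integral of 1/(t L) over [e, a] equal to M. *)
pose e := expR (- expR (ln (- ln a) + M)).
have lne : ln (- ln e) = ln (- ln a) + M by rewrite /e expRK opprK expRK.
have e0 : 0 < e by exact: expR_gt0.
have ea : e < a.
  rewrite -[ltRHS]lnK ?posrE// ltr_expR ltrNl -[ltLHS]lnK ?posrE// ltr_expR.
  by rewrite ltrDl.
pose G1 := e `^ (- 2 / q) * (- ln e) `^ (r / q).
have G1_ge0 : 0 <= G1 by rewrite mulr_ge0 ?powR_ge0.
have we0 : 0 < cusp_width r e by rewrite cusp_width_gt0// e0 (le_trans (ltW ea)).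
pose G := G1 + G1 / cusp_width r e.
have G_ge0 : 0 <= G by rewrite addr_ge0 ?divr_ge0// ltW.
have sigma_le1 t : e <= t <= a -> flux_weight r q t <= G1.
  by move=> /andP[et ta]; apply: flux_weight_le => //; exact: le_trans a1.
have sigma_le t : e <= t <= a -> flux_weight r q t <= G.
  by move=> /sigma_le1/le_trans; apply; rewrite lerDl divr_ge0// ltW.
have sigma_w_le t : e <= t <= a -> flux_weight r q t / cusp_width r t <= G.
  move=> eta_t; have [et ta] := andP eta_t.
  have wt : cusp_width r e <= cusp_width r t.
    by apply: ler_cusp_width => //; exact: le_trans a1.
  apply: (@le_trans _ _ (G1 / cusp_width r e)); last by rewrite lerDr.
  apply: ler_pM; rewrite ?flux_weight_ge0 ?invr_ge0 ?sigma_le1//.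
    by rewrite (le_trans _ wt)// ltW.
  by rewrite lef_pV2// posrE// (lt_le_trans we0).
pose eta := (4 * G + 1)^-1.
have G41 : 0 < 4 * G + 1 by rewrite ltr_wpDl// mulr_ge0.
have eta_gt0 : 0 < eta by rewrite invr_gt0.
have [phi tphi /W1p_dist_lt[dx_le dy_le]] := u1_0 _ eta_gt0.
have [psi tpsi /W1p_dist_lt[_ dy2_le]] := u2_0 _ eta_gt0.
have [_ _ _ cphix cphiy] := test_fun_C1 tphi.
have [_ _ _ _ cpsiy] := test_fun_C1 tpsi.
have mQ : measurable (`[0, a] `*` `[- a, a] :
    set (measurableTypeR R * measurableTypeR R)).
  by apply: measurableX; exact: measurable_itv.
have Q1 : (@leb2 R (`[0%R, a] `*` `[(- a)%R, a]) <= 1)%E.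
  rewrite leb2_box ?lee_fin ?subr0 ?opprK//; first exact: ltW.
  by apply: (@le_trans _ _ 0); rewrite ?oppr_le0 ltW.
have L1 (g F : R * R -> R) : continuous F -> in_Lp Omega p g ->
    (Lp_norm Omega p (g \- F)%R <= eta%:E)%E ->
    (\int[@leb2 R]_(z in `[0%R, a] `*` `[(- a)%R, a])
      `|((g \- F)%R \_ Omega) z|%:E <= eta%:E)%E.
  move=> cF gLp; apply: L1_le_Lp_norm => //.
  by apply: measurable_restrict_sub => //; exact: in_Lp_measurable gLp.
have := weighted_flux_le p0 r0 a0 a1 c_gt0 b0 gam_le openO OmegaE (mdx u1)
  (mdy u2) div_ge tphi tpsi q0 pq erefl (mdy u1) e0 ea G_ge0 l0 (ltW eta_gt0)
  sigma_le sigma_w_le V_le (L1 _ _ cphix (W1p_dx_Lp u1) dx_le)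
  (L1 _ _ cpsiy (W1p_dy_Lp u2) dy2_le) (L1 _ _ cphiy (W1p_dy_Lp u1) dy_le).
rewrite -/kappa -/C lne addrAC subrr add0r.
have -> : 4 * l = kappa / 2 by rewrite /l; field.
have MK : kappa / 2 * M = 2 * C * V + 2.
  by rewrite /M mulrC divfK// gt_eqF// divr_gt0.
have Geta : 4 * G * eta <= 1 by rewrite /eta ler_pdivrMr// mul1r lerDl.
clear -MK Geta; lra.
Qed.
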